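(* For every $n$-qubit density operator $\rho$, $$\Gamma(\rho)\ \ge\ 1+\frac{C(\rho)}{M_n}.$$ Consequently $\Gamma(\rho)^2\ge\bigl(1+C(\rho)/M_n\bigr)^2$.
   Context: Let $I,X,Y,Z$ be the Pauli matrices. For $(q,p)\in\mathbb{F}_2^2$ define the single-qubit phase-point operator $A_{(q,p)}=\tfrac12\bigl(I+(-1)^pX+(-1)^{q+p}Y+(-1)^qZ\bigr)$. For $n$ qubits and $\alpha=(\alpha_1,\dots,\alpha_n)\in(\mathbb{F}_2^2)^n$ set $A_\alpha=A_{\alpha_1}\otimes\cdots\otimes A_{\alpha_n}$. The discrete Wigner function of an $n$-qubit operator $\rho$ is $W_\rho(\alpha)=2^{-n}\mathrm{Tr}(\rho A_\alpha)$, regarded as a vector in $\mathbb{R}^{4^n}$. $\mathrm{Stab}_n$ denotes the set of pure $n$-qubit stabilizer states, i.e. density operators $|\psi\rangle\langle\psi|$ with $|\psi\rangle$ the unique common $+1$ eigenvector of an abelian subgroup of the $n$-qubit Pauli group of size $2^n$ (not containing $-I$). The free Wigner polytope is $\mathcal{W}_{\mathrm{free}}=\mathrm{conv}\{W_\sigma:\sigma\in\mathrm{Stab}_n\}$, and the Wigner distance is $C(\rho)=\min_{f\in\mathcal{W}_{\mathrm{free}}}\|W_\rho-f\|_1$. The stabilizer extent (for mixed states) is $\Gamma(\rho)=\min\{\sum_i|\alpha_i|:\rho=\sum_i\alpha_i\sigma_i,\ \alpha_i\in\mathbb{R},\ \sigma_i\in\mathrm{Stab}_n\}$ (finite sums).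 $M_n=\max_{\sigma\in\mathrm{Stab}_n}\|W_\sigma\|_1$. *)

(* Defs.v *)
From HB Require Import structures.
From mathcomp Require Import all_boot all_order all_algebra.
From mathcomp Require Import sesquilinear spectral.
From mathcomp Require Import complex.
From mathcomp Require Import classical_sets reals.
Set Implicit Arguments. Unset Strict Implicit. Unset Printing Implicit Defensive.
Import Order.TTheory GRing.Theory Num.Theory.
Local Open Scope ring_scope.

Definition iu (R : realType) : R[i] := Complex 0 1.

(* single-qubit Pauli matrices, indexed by 'I_2 (0 ~ |0>, 1 ~ |1>) *)
Definition pX (R : realType) : 'M[R[i]]_2 :=
  \matrix_(a < 2, b < 2) (if a == b then 0 else 1).
Definition pY (R : realType) : 'M[R[i]]_2 :=
  \matrix_(a < 2, b < 2)
    (if a == b then 0 else if val a == 0%N then - iu R else iu R).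
Definition pZ (R : realType) : 'M[R[i]]_2 :=
  \matrix_(a < 2, b < 2)
    (if a == b then (if val a == 0%N then 1 else -1) else 0).

Definition pauli1 (R : realType) (a : 'I_4) : 'M[R[i]]_2 :=
  match val a with
  | 0 => 1%:M | 1 => pX R | 2 => pY R | _ => pZ R end.

(* k-th qubit (bit) of a computational basis index i < 2^n *)
Definition qbit (n : nat) (k : 'I_n) (i : 'I_(2 ^ n)) : 'I_2 :=
  inord ((i %/ 2 ^ k) %% 2).

Definition tens (R : realType) (n : nat) (A : 'I_n -> 'M[R[i]]_2)
  : 'M[R[i]]_(2 ^ n) :=
  \matrix_(i, j) \prod_(k < n) A k (qbit k i) (qbit k j).

Definition adj (R : realType) (m p : nat) (M : 'M[R[i]]_(m, p)) : 'M[R[i]]_(p, m) :=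
  map_mx (@real_closed.complex.conjc R) M^T.

Definition is_pauli (R : realType) (n : nat) (g : 'M[R[i]]_(2 ^ n)) : Prop :=
  exists (k : 'I_4) (w : 'I_n -> 'I_4),
    g = (iu R ^+ k) *: tens (fun q => pauli1 R (w q)).

Definition is_stab_group (R : realType) (n : nat) (S : seq 'M[R[i]]_(2 ^ n)) : Prop :=
  [/\ uniq S /\ size S = (2 ^ n)%N,
      forall g, g \in S -> is_pauli g,
      (1%:M \in S) /\ (forall g, g \in S -> invmx g \in S)
                   /\ (forall g h, g \in S -> h \in S -> g *m h \in S),
      forall g h, g \in S -> h \in S -> g *m h = h *m g
    & (- 1%:M) \notin S].

Definition stab_state (R : realType) (n : nat) (sigma : 'M[R[i]]_(2 ^ n)) : Prop :=
  exists (S : seq 'M[R[i]]_(2 ^ n)) (psi : 'cV[R[i]]_(2 ^ n)),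
    [/\ is_stab_group S,
        adj psi *m psi = 1,
        forall g, g \in S -> g *m psi = psi,
        forall phi : 'cV[R[i]]_(2 ^ n),
          (forall g, g \in S -> g *m phi = phi) -> exists c, phi = c *: psi
      & sigma = psi *m adj psi].

Definition density (R : realType) (n : nat) (rho : 'M[R[i]]_(2 ^ n)) : Prop :=
  [/\ adj rho = rho, \tr rho = 1
    & forall v : 'cV[R[i]]_(2 ^ n), 0 <= (adj v *m rho *m v) 0 0].

(* phase space points alpha in (F_2^2)^n, alpha_k = (q_k, p_k) *)
Definition phase (n : nat) := {ffun 'I_n -> bool * bool}.

Definition sgn (R : realType) (b : bool) : R[i] := (-1) ^+ b.

Definition A1 (R : realType) (qp : bool * bool) : 'M[R[i]]_2 :=
  let: (q, p) := qp in
  (2%:R)^-1 *: (1%:M + sgn R p *: pX R + sgn R (q (+) p) *: pY R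
                + sgn R q *: pZ R).

Definition Aop (R : realType) (n : nat) (alpha : phase n) : 'M[R[i]]_(2 ^ n) :=
  tens (fun k => A1 R (alpha k)).

(* discrete Wigner function W_rho(alpha) = 2^-n Tr(rho A_alpha); it is real
   for Hermitian rho, and we record its real part *)
Definition wigner (R : realType) (n : nat) (rho : 'M[R[i]]_(2 ^ n))
  (alpha : phase n) : R :=
  real_closed.complex.Re (((2 ^ n)%:R)^-1 * \tr (rho *m Aop R alpha)).

Definition l1 (R : realType) (n : nat) (f : phase n -> R) : R :=
  \sum_(alpha : phase n) `|f alpha|.

Definition Wfree (R : realType) (n : nat) (f : phase n -> R) : Prop :=
  exists s : seq (R * 'M[R[i]]_(2 ^ n)),
    [/\ forall x, x \in s -> 0 <= x.1 /\ stab_state x.2,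
        \sum_(x <- s) x.1 = 1
      & forall alpha, f alpha = \sum_(x <- s) x.1 * wigner x.2 alpha].

Local Open Scope classical_set_scope.

Definition wdist (R : realType) (n : nat) (rho : 'M[R[i]]_(2 ^ n)) : R :=
  inf [set d : R | exists f, Wfree f /\
                   d = l1 (fun alpha => wigner rho alpha - f alpha)].

Definition extent (R : realType) (n : nat) (rho : 'M[R[i]]_(2 ^ n)) : R :=
  inf [set t : R | exists s : seq (R * 'M[R[i]]_(2 ^ n)),
         [/\ forall x, x \in s -> stab_state x.2,
             rho = \sum_(x <- s) (x.1)%:C%C *: x.2
           & t = \sum_(x <- s) `|x.1|]].

Definition Mn (R : realType) (n : nat) : R :=
  sup [set t : R | exists sigma : 'M[R[i]]_(2 ^ n),
         stab_state sigma /\ t = l1 (wigner sigma)].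

(* Main.v *)
(* A decomposition of [rho] into stabilizer states with weights [a_i] has
   [sum a_i = 1] by taking traces.  Let [p] and [-q] be the sums of the positive
   and of the negative weights, so that [p - q = 1].  Dividing the positive part
   by [p] gives a point [f] of the free polytope, and [W_rho - f] is a
   combination of stabilizer Wigner functions of total weight
   [(p - 1) + q = sum |a_i| - 1]; hence [C(rho) <= (sum |a_i| - 1) * M_n].

   Since [inf] and [sup] are [0] on empty or unbounded sets, one also needs that
   [M_n] is the supremum of a bounded set and that [rho] has at least one
   decomposition.  For the latter, the projectors onto [|0>, |1>, |+>, |+i>] span
   the 2x2 matrices, so their tensor products span all matrices, and a Hermitian
   matrix keeps only the real parts of its coefficients. *)

Require Import Defs.
From mathcomp Require Import all_boot all_order all_algebra.
From mathcomp Require Import spectral complex boolp classical_sets reals.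
From mathcomp Require Import ring lra.
Set Implicit Arguments. Unset Strict Implicit. Unset Printing Implicit Defensive.
Import Order.TTheory GRing.Theory Num.Theory.
Local Open Scope ring_scope.

(** * Basis indices as bit strings *)

Lemma qbit_inj n (i j : 'I_(2 ^ n)) :
  (forall k : 'I_n, qbit k i = qbit k j) -> i = j.
Proof.
move=> eq_ij; apply: val_inj => /=.
have bit k : (k < n)%N -> ((i %/ 2 ^ k) %% 2 = (j %/ 2 ^ k) %% 2)%N.
  move=> ltkn; move/(congr1 val): (eq_ij (Ordinal ltkn)).
  by rewrite /qbit /= !inordK ?ltn_mod.
have: (i < 2 ^ n)%N by []. have: (j < 2 ^ n)%N by [].
move: (i : nat) (j : nat) bit {eq_ij} => {}i {}j.
elim: n i j => [|n IHn] i j bit ltj lti.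
  by move: ltj lti; rewrite expn0 !ltnS !leqn0 => /eqP-> /eqP->.
have e0 := bit 0%N isT; rewrite expn0 !divn1 in e0.
(* The lowest bits agree; the halves have the same bits shifted by one, so induction applies to
   them. *)
rewrite (divn_eq i 2) (divn_eq j 2) e0; congr (_ * _ + _)%N.
apply: IHn; rewrite ?ltn_divLR ?(mulnC _ 2%N) -?expnS // => k ltk.
  by rewrite -!divnMA -!expnS; apply: bit.
Qed.

Definition bits n (i : 'I_(2 ^ n)) : {ffun 'I_n -> 'I_2} := [ffun k => qbit k i].

Lemma bits_bij n : bijective (@bits n).
Proof.
apply: inj_card_bij => [i j /ffunP eq_ij|].
  by apply: qbit_inj => k; have := eq_ij k; rewrite !ffunE.
by rewrite card_ffun !card_ord.
Qed.

(** * Tensor products of 2x2 matrices *)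

Section Tensor.
Context {R : realType} {n : nat}.
Local Notation C := R[i].
Implicit Types (A B : 'I_n -> 'M[C]_2).

(** Distributivity, once basis indices are replaced by bit strings. Multiplicativity of [tens] and
    of its trace both reduce to it. *)
Lemma sum_prod_qbit (F : 'I_n -> 'I_2 -> C) :
  \sum_(i < 2 ^ n) \prod_k F k (qbit k i) = \prod_k \sum_a F k a.
Proof.
rewrite bigA_distr_bigA /=.
have [g gK Kg] := bits_bij n.
rewrite (reindex (@bits n)) /=; last by exists g => x _.
by apply: eq_bigr => i _; apply: eq_bigr => k _; rewrite ffunE.
Qed.

Lemma eq_tens A B : A =1 B -> tens A = tens B.
Proof.
by move=> eqAB; apply/matrixP=> i j; rewrite !mxE; apply: eq_bigr=> k _; rewrite eqAB.
Qed.

Lemma tensM A B : tens A *m tens B = tens (fun k => A k *m B k).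
Proof.
apply/matrixP=> i j; rewrite !mxE.
under eq_bigr do rewrite !mxE -big_split /=.
rewrite (sum_prod_qbit (fun k a => A k (qbit k i) a * B k a (qbit k j))).
by apply: eq_bigr => k _; rewrite mxE.
Qed.

Lemma tens1 : tens (fun _ => 1%:M : 'M[C]_2) = 1%:M :> 'M_(2 ^ n).
Proof.
apply/matrixP=> i j; rewrite !mxE; have [->|neq_ij] := eqVneq i j.
  by rewrite big1 // => k _; rewrite mxE eqxx.
have [k neqk] : exists k : 'I_n, qbit k i != qbit k j.
  apply/existsP; apply: contraNT neq_ij; rewrite negb_exists => /forallP eqk.
  by apply/eqP/qbit_inj => k; apply/eqP; have := eqk k; rewrite negbK.
by rewrite (bigD1 k) //= mxE (negbTE neqk) mul0r.
Qed.

Lemma tens_tr A : \tr (tens A) = \prod_k \tr (A k).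
Proof.
rewrite /mxtrace -sum_prod_qbit; apply: eq_bigr => i _; by rewrite mxE.
Qed.

Lemma tensZ (c : 'I_n -> C) A :
  tens (fun k => c k *: A k) = (\prod_k c k) *: tens A.
Proof.
apply/matrixP=> i j; rewrite !mxE -big_split /=.
by apply: eq_bigr => k _; rewrite mxE.
Qed.

Lemma tens_sum (J : finType) (F : 'I_n -> J -> 'M[C]_2) :
  tens (fun k => \sum_b F k b) =
  \sum_(x : {ffun 'I_n -> J}) tens (fun k => F k (x k)).
Proof.
apply/matrixP=> i j; rewrite !mxE summxE.
under [RHS]eq_bigr do rewrite mxE.
rewrite -(bigA_distr_bigA (fun k b => F k b (qbit k i) (qbit k j))).
by apply: eq_bigr => k _; rewrite summxE.
Qed.

Definition tensv (v : 'I_n -> 'cV[C]_2) : 'cV[C]_(2 ^ n) :=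
  \col_i \prod_k v k (qbit k i) 0.

Lemma tensv_proj (v : 'I_n -> 'cV[C]_2) :
  tensv v *m adj (tensv v) = tens (fun k => v k *m adj (v k)).
Proof.
apply/matrixP=> i j; rewrite !mxE big_ord1 !mxE rmorph_prod -big_split /=.
by apply: eq_bigr => k _; rewrite !mxE big_ord1 !mxE.
Qed.

Lemma delta_tens (i j : 'I_(2 ^ n)) :
  delta_mx i j = tens (fun k => delta_mx (qbit k i) (qbit k j)) :> 'M[C]_(2 ^ n).
Proof.
apply/matrixP=> i' j'; rewrite !mxE.
have [/andP[/eqP-> /eqP->]|] := boolP ((i' == i) && (j' == j)).
  by rewrite big1 // => k _; rewrite mxE !eqxx.
move=> neq; have [k neqk] : exists k : 'I_n,
    ~~ ((qbit k i' == qbit k i) && (qbit k j' == qbit k j)).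
  apply/existsP; apply: contraNT neq; rewrite negb_exists => /forallP eqk.
  by apply/andP; split; apply/eqP/qbit_inj => k; apply/eqP;
     have := eqk k; rewrite negbK => /andP[].
by rewrite (bigD1 k) //= mxE (negbTE neqk) mul0r.
Qed.

End Tensor.

(** * Four single-qubit stabilizer states and their span *)

Section SingleQubit.
Context {R : realType}.
Local Notation C := R[i].

(* [|0>, |1>, |+>, |+i>] for [(false, false), (false, true), (true, false),
   (true, true)]. *)
Definition ket (m : bool * bool) : 'cV[C]_2 :=
  \col_a (if m.1 then (Num.sqrt 2^-1)%:C%C *
            (if a == 0 then 1 else if m.2 then iu R else 1)
          else (a == m.2 :> nat)%:R).

(** Sign and letter of the Pauli observable fixing [ket m]; only |1> needs a minus sign. They are
    kept apart so that the phase of a tensor product can be collected. *)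
Definition obs_sign (m : bool * bool) : bool := ~~ m.1 && m.2.
Definition obs_pauli (m : bool * bool) : 'I_4 :=
  if m.1 then if m.2 then inord 2 else inord 1 else inord 3.

Definition obs (m : bool * bool) : 'M[C]_2 :=
  (-1) ^+ obs_sign m *: pauli1 R (obs_pauli m).

Lemma obsE m : obs m = if m.1 then if m.2 then pY R else pX R
                       else if m.2 then - pZ R else pZ R.
Proof.
by case: m => [[] []]; rewrite /obs /obs_sign /obs_pauli /pauli1 /= inordK //=
  ?expr0 ?expr1 ?scale1r ?scaleN1r.
Qed.

Lemma iuM : iu R * iu R = -1.
Proof. by apply/eqP; rewrite eq_complex /=; apply/andP; split; apply/eqP; ring. Qed.

Lemma forall_ord2 (P : 'I_2 -> Prop) : P 0 -> P 1 -> forall a, P a.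
Proof.
move=> P0 P1 [[|[|//]] lta].
  by rewrite (_ : Ordinal lta = 0) //; apply: val_inj.
by rewrite (_ : Ordinal lta = 1) //; apply: val_inj.
Qed.

Local Arguments real_closed.complex.conjc : simpl never.

Lemma conj_iu : conjc (iu R) = - iu R.
Proof. by apply/eqP; rewrite eq_complex /conjc /= oppr0 !eqxx. Qed.

Lemma obs_sqr m : obs m *m obs m = 1%:M.
Proof.
rewrite obsE; case: m => [[] []]; apply/matrixP => /=;
  apply: forall_ord2; apply: forall_ord2;
  by rewrite !mxE big_ord_recl big_ord1 !mxE /=; ring: iuM.
Qed.

Lemma obs_tr m : \tr (obs m) = 0.
Proof.
rewrite obsE /mxtrace big_ord_recl big_ord1.
by case: m => [[] []]; rewrite !mxE /=; ring.
Qed.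

Lemma ket_proj m : ket m *m adj (ket m) = 2^-1 *: (1%:M + obs m).
Proof.
have rr : (Num.sqrt 2^-1)%:C%C * (Num.sqrt 2^-1)%:C%C = 2^-1 :> C.
  by rewrite -rmorphM -expr2 sqr_sqrtr ?invr_ge0 // fmorphV rmorph_nat.
have rc : conjc (Num.sqrt (2 : R)^-1)%:C%C = (Num.sqrt 2^-1)%:C%C by exact: conjc_real.
have rh : 2 * 2^-1 = 1 :> C by rewrite divff ?pnatr_eq0.
(* With the root of 1/2 and 1/2 itself turned into variables, each entry is a polynomial identity
   modulo [rr], [rh] and [iuM]. *)
rewrite obsE /ket; move: (_%:C%C) rr rc => r; move: (2^-1) rh => h rh rr rc.
case: m => [[] []]; apply/matrixP;
  apply: forall_ord2; apply: forall_ord2; rewrite !mxE big_ord1 !mxE /=;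
  rewrite ?rmorphM ?rmorph1 ?rmorph0 /= ?rc ?conj_iu ?mulr1 ?mulrN;
  ring: rr rh iuM.
Qed.

(* The coefficients come from [M = M00 |0><0| + M11 |1><1| + ((M01 + M10) X
   + i (M01 - M10) Y) / 2], where [X] and [Y] are twice a projector minus 1. *)
Definition ket_coef (M : 'M[C]_2) (m : bool * bool) : C :=
  let d := (M 0 1 + M 1 0 + iu R * (M 0 1 - M 1 0)) / 2 in
  match m with
  | (true, false) => M 0 1 + M 1 0
  | (true, true) => iu R * (M 0 1 - M 1 0)
  | (false, false) => M 0 0 - d
  | (false, true) => M 1 1 - d
  end.

Lemma ket_span M : M = \sum_m ket_coef M m *: (ket m *m adj (ket m)).
Proof.
have sum4 (F : bool * bool -> C) : \sum_m F m =
    F (true, true) + F (true, false) + (F (false, true) + F (false, false)).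
  rewrite (eq_bigr (fun m => F (m.1, m.2))) => [|[] //].
  by rewrite -(pair_bigA _ (fun a b => F (a, b))) /= !big_bool.
have projE c m i j : (c *: (ket m *m adj (ket m))) i j =
    c * (2^-1 * ((i == j)%:R + obs m i j)) by rewrite ket_proj !mxE.
have entE m i j : obs m i j =
    if m.1 then if i == j then 0
                else if m.2 then if i == 0 then - iu R else iu R else 1
    else if i == j then if (i == 0) (+) m.2 then 1 else -1 else 0.
  rewrite obsE; case: m => [[] []]; rewrite !mxE //=;
    move: i j; apply: forall_ord2; apply: forall_ord2; by rewrite /= ?oppr0 ?opprK.
apply/matrixP=> i j; rewrite summxE (eq_bigr _ (fun m _ => projE _ m i j)) sum4 !entE.
move: i j; apply: forall_ord2; apply: forall_ord2 => /=; by field: iuM.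
Qed.

End SingleQubit.

(** * Product kets are stabilizer states *)

Section ProductState.
Context {R : realType} {n : nat}.
Local Notation C := R[i].
Context (m : {ffun 'I_n -> bool * bool}).

Definition prod_ket : 'cV[C]_(2 ^ n) := tensv (fun k => ket (m k)).

(** The stabilizer group of [prod_ket], parametrized by the set of qubits on which the observable
    acts; multiplication becomes bitwise xor. *)
Definition prod_stab (x : {ffun 'I_n -> bool}) : 'M[C]_(2 ^ n) :=
  tens (fun k => if x k then obs (m k) else 1%:M).

Lemma prod_stabM x y :
  prod_stab x *m prod_stab y = prod_stab [ffun k => x k (+) y k].
Proof.
rewrite tensM; apply: eq_tens => k; rewrite ffunE.
by case: (x k) (y k) => [] []; rewrite /= ?mul1mx ?mulmx1 ?obs_sqr.
Qed.

Lemma prod_stab0 : prod_stab [ffun=> false] = 1%:M.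
Proof. by rewrite -tens1; apply: eq_tens => k; rewrite ffunE. Qed.

Lemma prod_stab_sqr x : prod_stab x *m prod_stab x = 1%:M.
Proof.
rewrite prod_stabM -prod_stab0; congr prod_stab.
by apply/ffunP=> k; rewrite !ffunE addbb.
Qed.

(** The squared norm is the trace of the projector, a product of traces of (1 + [obs])/2, each equal
    to 1. *)
Lemma prod_ket_norm : adj prod_ket *m prod_ket = 1.
Proof.
rewrite [LHS]mx11_scalar -trace_mx11 mxtrace_mulC tensv_proj tens_tr big1 // => k _.
by rewrite ket_proj mxtraceZ mxtraceD mxtrace1 obs_tr addr0 mulVf ?pnatr_eq0.
Qed.

Lemma prod_stab_ket x : prod_stab x *m prod_ket = prod_ket.
Proof.
(* Writing the ket as its projector applied to itself reduces the claim to single-qubit projectors,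
   which absorb [obs]. *)
rewrite -{1}[prod_ket]mulmx1 -[1%:M]prod_ket_norm !mulmxA -(mulmxA (prod_stab x)).
rewrite tensv_proj tensM.
rewrite (_ : tens _ = prod_ket *m adj prod_ket).
  by rewrite -mulmxA prod_ket_norm mulmx1.
rewrite tensv_proj; apply: eq_tens => k; case: (x k); rewrite ?mul1mx //.
by rewrite ket_proj -scalemxAr mulmxDr mulmx1 obs_sqr addrC.
Qed.

(** Expanding the tensor product of the factors 1 + [obs] gives the group sum; each factor is twice
    a projector. *)
Lemma prod_stab_sum :
  \sum_x prod_stab x = 2 ^+ n *: (prod_ket *m adj prod_ket).
Proof.
rewrite -(tens_sum (fun k (b : bool) => if b then obs (m k) else 1%:M)) tensv_proj.
rewrite (_ : 2 ^+ n = \prod_(k < n) 2); last by rewrite prodr_const card_ord.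
rewrite -tensZ; apply: eq_tens => k.
by rewrite big_bool ket_proj scalerA divff ?pnatr_eq0 // scale1r addrC.
Qed.

(** If [x] and [y] differ at a qubit, the product of their images has a traceless factor there, so
    it cannot be the identity. *)
Lemma prod_stab_inj : injective prod_stab.
Proof.
move=> x y eqxy; apply/ffunP => k; apply/eqP; apply: contraT => neqk.
have /(congr1 mxtrace) : prod_stab x *m prod_stab y = 1%:M.
  by rewrite eqxy prod_stab_sqr.
rewrite prod_stabM tens_tr (bigD1 k) //= ffunE.
rewrite (_ : x k (+) y k = true); last by case: (x k) (y k) neqk => [] [].
by rewrite obs_tr mul0r mxtrace1 => /esym/eqP; rewrite pnatr_eq0 expn_eq0.
Qed.

Lemma prod_stab_pauli x : is_pauli (prod_stab x).
Proof.
pose b k := x k && obs_sign (m k).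
(* The total sign is a power of -1 = i^2; reducing the count of minus signs to its parity keeps the
   exponent of i below 4. *)
exists (inord (odd (\sum_k b k)).*2), (fun k => if x k then obs_pauli (m k) else ord0).
rewrite inordK; last by case: odd.
rewrite -mul2n exprM expr2 iuM signr_odd -prodrXr -tensZ; apply: eq_tens => k.
by rewrite /b; case: (x k); rewrite //= expr0 scale1r.
Qed.

Lemma prod_stab_state : stab_state (prod_ket *m adj prod_ket).
Proof.
exists [seq prod_stab x | x <- enum {ffun 'I_n -> bool}], prod_ket; split=> //.
- split.
  + rewrite map_inj_uniq ?enum_uniq //; last exact: prod_stab_inj.
    by rewrite size_map -cardE card_ffun card_bool card_ord.
  + by move=> g /mapP[x _ ->]; apply: prod_stab_pauli.
  + split; first by rewrite -prod_stab0 map_f ?mem_enum.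
    split=> [g /mapP[x _ ->]|g h /mapP[x _ ->] /mapP[y _ ->]].
      have inv : invmx (prod_stab x) = prod_stab x.
        have [u _] := mulmx1_unit (prod_stab_sqr x).
        by rewrite -[LHS]mulmx1 -(prod_stab_sqr x) mulKmx.
      by rewrite inv map_f ?mem_enum.
    by rewrite prod_stabM map_f ?mem_enum.
  + move=> g h /mapP[x _ ->] /mapP[y _ ->]; rewrite !prod_stabM; congr prod_stab.
    by apply/ffunP=> k; rewrite !ffunE addbC.
  (* If -1 were in the group, the unit vector [prod_ket] would equal its own negative. *)
  + apply/negP => /mapP[x _ eqN].
    have := prod_stab_ket x; rewrite -eqN mulNmx mul1mx => psiN.
    have psi0 : prod_ket = 0.
      apply/matrixP=> i j; move/matrixP/(_ i j): psiN; rewrite !mxE => /eqP.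
      by rewrite eq_sym -subr_eq0 opprK -mulr2n mulrn_eq0 => /eqP.
    have /matrixP/(_ 0 0) := prod_ket_norm; rewrite psi0 mulmx0 !mxE => /esym/eqP.
    by rewrite oner_eq0.
- exact: prod_ket_norm.
- by move=> g /mapP[x _ ->]; apply: prod_stab_ket.
(* The group sum multiplies a fixed [phi] by 2^n, but it is also 2^n times the projector, so [phi]
   is its own projection onto [prod_ket]. *)
- move=> phi fix_phi; exists ((adj prod_ket *m phi) 0 0).
  have N0 : 2 ^+ n != 0 :> C by rewrite expf_neq0 ?pnatr_eq0.
  have sum_phi : (\sum_x prod_stab x) *m phi = 2 ^+ n *: phi.
    rewrite mulmx_suml (eq_bigr (fun=> phi)) => [|x _]; last first.
      by apply: fix_phi; rewrite map_f ?mem_enum.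
    by rewrite sumr_const card_ffun card_bool card_ord -scaler_nat natrX.
  apply: (scalerI N0); rewrite -sum_phi prod_stab_sum -scalemxAl -mulmxA.
  by rewrite {1}[adj prod_ket *m phi]mx11_scalar mul_mx_scalar.
Qed.

End ProductState.

(** * Decomposing Hermitian matrices into stabilizer states *)

Section Span.
Context {R : realType} {n : nat}.
Local Notation C := R[i].

Lemma adj_sum I (r : seq I) p q (F : I -> 'M[C]_(p, q)) :
  adj (\sum_(i <- r) F i) = \sum_(i <- r) adj (F i).
Proof. by rewrite /adj raddf_sum raddf_sum. Qed.

(** Each matrix unit is a tensor product of 2x2 matrix units; expanding every factor by [ket_span]
    gives product projectors. *)
Lemma prod_ket_span (rho : 'M[C]_(2 ^ n)) :
  exists c : {ffun 'I_n -> bool * bool} -> C,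
    rho = \sum_m c m *: (prod_ket m *m adj (prod_ket m)).
Proof.
pose d i j (m : {ffun 'I_n -> bool * bool}) : C :=
  \prod_k ket_coef (delta_mx (qbit k i) (qbit k j)) (m k).
have delta_span i j :
    delta_mx i j = \sum_m d i j m *: (prod_ket m *m adj (prod_ket m)).
  rewrite delta_tens (eq_tens (fun k => ket_span _)) tens_sum.
  by apply: eq_bigr => m _; rewrite tensv_proj -tensZ.
exists (fun m => \sum_i \sum_j rho i j * d i j m).
rewrite {1}[rho]matrix_sum_delta.
under [RHS]eq_bigr do rewrite scaler_suml.
rewrite [RHS]exchange_big; apply: eq_bigr => i _ /=.
under [RHS]eq_bigr do rewrite scaler_suml.
rewrite [RHS]exchange_big; apply: eq_bigr => j _ /=.
rewrite delta_span scaler_sumr; apply: eq_bigr => m _; by rewrite scalerA.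
Qed.

Lemma hermitian_stab_span (rho : 'M[C]_(2 ^ n)) : adj rho = rho ->
  exists s : seq (R * 'M[C]_(2 ^ n)),
    (forall x, x \in s -> stab_state x.2) /\
    rho = \sum_(x <- s) (x.1)%:C%C *: x.2.
Proof.
move=> rhoH; have [c rhoE] := prod_ket_span rho.
exists [seq (complex.Re (c m), prod_ket m *m adj (prod_ket m)) |
        m <- enum {ffun 'I_n -> bool * bool}].
split=> [x /mapP[m _ ->]|]; first exact: prod_stab_state.
rewrite big_map big_enum /=.
(* Averaging the expansion with its adjoint turns each [c m] into its real part, as the projectors
   are Hermitian. *)
have rho2 : rho = 2^-1 *: (rho + adj rho).
  by rewrite rhoH -mulr2n -[rho *+ 2]scaler_nat scalerA mulVf ?scale1r ?pnatr_eq0.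
rewrite [LHS]rho2 rhoE adj_sum -big_split scaler_sumr; apply: eq_bigr => m _ /=.
have -> : adj (c m *: (prod_ket m *m adj (prod_ket m))) =
          conjc (c m) *: (prod_ket m *m adj (prod_ket m)).
  apply/matrixP=> i j; rewrite !mxE !big_ord1 !mxE !rmorphM /= conjcK; congr (_ * _).
  by rewrite mulrC.
by rewrite -scalerDl scalerA addcJ mulKf ?pnatr_eq0.
Qed.

End Span.

(** * Wigner norms and the bound on the Wigner distance *)

Section Wigner.
Context {R : realType} {n : nat}.
Local Notation C := R[i].
Local Notation Re := complex.Re.

Lemma stab_state_tr (sigma : 'M[C]_(2 ^ n)) : stab_state sigma -> \tr sigma = 1.
Proof.
by case=> S [psi [_ psi1 _ _ ->]]; rewrite mxtrace_mulC psi1 trace_mx11 mxE.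
Qed.

Lemma stab_state_norm (sigma : 'M[C]_(2 ^ n)) i j :
  stab_state sigma -> `|sigma i j| <= 1.
Proof.
case=> S [psi [_ psi1 _ _ ->]].
have le1 k : `|psi k 0| <= 1.
  rewrite -(@expr_le1 _ 2) //.
  have /matrixP/(_ 0 0) := psi1; rewrite !mxE eqxx => sum1.
  rewrite -[leRHS]/(true%:R) -sum1.
  under eq_bigr do rewrite !mxE mulrC -sqr_normc.
  by rewrite (bigD1 k) //= lerDl sumr_ge0 // => l _; rewrite exprn_ge0.
by rewrite !mxE big_ord1 !mxE normrM normcJ mulr_ile1.
Qed.

Lemma wignerD (a : R) (s t : 'M[C]_(2 ^ n)) alpha :
  wigner (a%:C%C *: s + t) alpha = a * wigner s alpha + wigner t alpha.
Proof.
rewrite /wigner mulmxDl mxtraceD -scalemxAl mxtraceZ mulrDr mulrCA.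
case: (_^-1 * \tr (s *m _)) (_^-1 * \tr (t *m _)) => [u v] [u' v'].
by rewrite /= mul0r subr0.
Qed.

Lemma wigner_sum (s : seq (R * 'M[C]_(2 ^ n))) alpha :
  wigner (\sum_(x <- s) (x.1)%:C%C *: x.2) alpha =
  \sum_(x <- s) x.1 * wigner x.2 alpha.
Proof.
elim: s => [|x s IHs]; last by rewrite !big_cons wignerD IHs.
by rewrite !big_nil /wigner mul0mx mxtrace0 mulr0.
Qed.

Lemma l1_sum (I : eqType) (s : seq I) (c : I -> R) (F : I -> phase n -> R) M :
  (forall x, x \in s -> l1 (F x) <= M) ->
  l1 (fun alpha => \sum_(x <- s) c x * F x alpha) <= (\sum_(x <- s) `|c x|) * M.
Proof.
move=> leM; rewrite mulr_suml /l1.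
apply: (@le_trans _ _ (\sum_(x <- s) `|c x| * l1 (F x))); last first.
  rewrite !big_seq; apply: ler_sum => x /leM; exact: ler_wpM2l.
under [leRHS]eq_bigr do rewrite mulr_sumr.
rewrite exchange_big /=; apply: ler_sum => alpha _.
apply: le_trans (ler_norm_sum _ _ _) _.
by apply: ler_sum => x _; rewrite normrM.
Qed.

Lemma l1_ge0 (f : phase n -> R) : 0 <= l1 f.
Proof. exact: sumr_ge0. Qed.

Lemma l1_wigner_le_Mn (sigma : 'M[C]_(2 ^ n)) :
  stab_state sigma -> l1 (wigner sigma) <= Mn R n.
Proof.
move=> stab; apply: ub_le_sup; last by exists sigma.
(* A bound uniform in the state: entries of a stabilizer state have modulus at most 1, so the trace
   against [Aop] is at most the sum of the moduli of its entries. *)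
exists (\sum_(alpha : phase n)
  Re (`|((2 ^ n)%:R)^-1| * \sum_i \sum_j `|Aop R alpha j i|)).
move=> _ [tau [tauS ->]]; apply: ler_sum => alpha _.
rewrite /wigner; set z := _ * \tr _.
suff: `|Re z|%:C%C <= `|((2 ^ n)%:R)^-1| * \sum_i \sum_j `|Aop R alpha j i|.
  by rewrite lecE => /andP[].
apply: le_trans (normc_ge_Re z) _; rewrite normrM ler_wpM2l //.
apply: le_trans (ler_norm_sum _ _ _) _; apply: ler_sum => i _.
rewrite mxE; apply: le_trans (ler_norm_sum _ _ _) _; apply: ler_sum => j _.
by rewrite normrM ler_piMl // stab_state_norm.
Qed.

Lemma stab_decomp_sum (rho : 'M[C]_(2 ^ n)) (s : seq (R * 'M[C]_(2 ^ n))) :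
  \tr rho = 1 -> (forall x, x \in s -> stab_state x.2) ->
  rho = \sum_(x <- s) (x.1)%:C%C *: x.2 -> \sum_(x <- s) x.1 = 1.
Proof.
move=> tr1 stab rhoE; apply: complexI; rewrite rmorph1 -tr1 rhoE !raddf_sum.
rewrite !big_seq; apply: eq_bigr => x /stab /stab_state_tr trx.
by rewrite /= mxtraceZ trx mulr1.
Qed.

Lemma wdist_ge0 (rho : 'M[C]_(2 ^ n)) : 0 <= wdist rho.
Proof.
(* On an empty set [inf] takes its default value 0. *)
rewrite /wdist; set E := mkset _; have [[d Ed]|E0] := pselect (E !=set0)%classic.
  apply: lb_le_inf; first by exists d.
  by move=> _ [f [_ ->]]; apply: l1_ge0.
by rewrite inf_out // => -[].
Qed.

Lemma wdist_le_decomp (rho : 'M[C]_(2 ^ n)) (s : seq (R * 'M[C]_(2 ^ n))) :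
  \tr rho = 1 -> (forall x, x \in s -> stab_state x.2) ->
  rho = \sum_(x <- s) (x.1)%:C%C *: x.2 ->
  wdist rho <= (\sum_(x <- s) `|x.1| - 1) * Mn R n.
Proof.
move=> tr1 stab rhoE; have sum1 := stab_decomp_sum tr1 stab rhoE.
set p := \sum_(x <- s | 0 <= x.1) x.1.
set q := \sum_(x <- s | ~~ (0 <= x.1)) x.1.
have pq : p + q = 1 by rewrite -sum1 (bigID (fun x : R * _ => 0 <= x.1)).
have normE : \sum_(x <- s) `|x.1| = p - q.
  rewrite (bigID (fun x : R * _ => 0 <= x.1)) /= -sumrN; congr (_ + _).
    by apply: eq_bigr => x x0; rewrite ger0_norm.
  by apply: eq_bigr => x; rewrite -ltNge => x0; rewrite ltr0_norm.
have q0 : q <= 0.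
  by rewrite -oppr_ge0 -sumrN sumr_ge0 // => x; rewrite -ltNge oppr_ge0 => /ltW.
(* This permits division by [p] and makes 1 - 1/[p] nonnegative. *)
have p1 : 1 <= p by lra.
have p0 : 0 < p by lra.
(* The weights of W_rho - [f]: subtracting [f] removes the fraction 1/[p] of each nonnegative
   weight. *)
pose c (x : R * 'M[C]_(2 ^ n)) := if 0 <= x.1 then (1 - p^-1) * x.1 else x.1.
pose f (alpha : phase n) := \sum_(x <- s | 0 <= x.1) x.1 / p * wigner x.2 alpha.
have freef : Wfree f.
  exists [seq (x.1 / p, x.2) | x <- s & 0 <= x.1]; split.
  - move=> y /mapP[x]; rewrite mem_filter => /andP[x0 xs] ->; split; last exact: (stab x).
    by rewrite /= divr_ge0 // ltW.
  - by rewrite big_map big_filter -mulr_suml divff ?gt_eqF.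
  - by move=> alpha; rewrite big_map big_filter.
have diffE alpha : wigner rho alpha - f alpha = \sum_(x <- s) c x * wigner x.2 alpha.
  rewrite rhoE wigner_sum (bigID (fun x : R * _ => 0 <= x.1)) /= addrAC -sumrB.
  rewrite [RHS](bigID (fun x : R * _ => 0 <= x.1)) /=; congr (_ + _).
    by apply: eq_bigr => x x0; rewrite /c x0; ring.
  by apply: eq_bigr => x /negbTE x0; rewrite /c x0.
have normc : \sum_(x <- s) `|c x| = p - q - 1.
  rewrite (bigID (fun x : R * _ => 0 <= x.1)) /=.
  have -> : p - q - 1 = (1 - p^-1) * p - q by rewrite mulrBl mulVf ?gt_eqF //; ring.
  rewrite /p /q mulr_sumr -sumrN; congr (_ + _); apply: eq_bigr => x x0.
    by rewrite /c x0 ger0_norm // mulr_ge0 // subr_ge0 invf_le1.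
  by rewrite /c (negbTE x0) ltr0_norm // ltNge.
rewrite normE -normc.
apply: le_trans (l1_sum c (fun x xs => l1_wigner_le_Mn (stab x xs))).
apply: ge_inf; first by exists 0 => _ [g [_ ->]]; apply: l1_ge0.
exists f; split=> //; apply: eq_bigr => alpha _; by rewrite diffE.
Qed.

End Wigner.

(** * The extent bound and its square *)

Theorem theorem3p3 (R : realType) (n : nat) (rho : 'M[R[i]]_(2 ^ n)) :
  density rho ->
  1 + wdist rho / Mn R n <= extent rho /\
  (1 + wdist rho / Mn R n) ^+ 2 <= extent rho ^+ 2.
Proof.
case=> rhoH tr1 _; have [s0 [stab0 rho0]] := hermitian_stab_span rhoH.
have M0 : 0 <= Mn R n.
  (* Weights summing to 1 cannot form an empty list, so some stabilizer state exists and its norm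
     bounds [Mn] from below. *)
  case: s0 stab0 rho0 => [|x s] stab rhoE.
    have := stab_decomp_sum tr1 stab rhoE.
    by rewrite big_nil => /esym/eqP; rewrite oner_eq0.
  by apply: le_trans (l1_ge0 _) (l1_wigner_le_Mn (stab x (mem_head _ _))).
have le1 : 1 + wdist rho / Mn R n <= extent rho.
  apply: lb_le_inf; first by exists (\sum_(x <- s0) `|x.1|), s0.
  move=> _ [s [stab rhoE ->]]; have leC := wdist_le_decomp tr1 stab rhoE.
  have [M00|M_neq0] := eqVneq (Mn R n) 0.
    (* junk value: [wdist rho / 0 = 0] *)
    rewrite M00 invr0 mulr0 addr0 -(stab_decomp_sum tr1 stab rhoE).
    by apply: ler_sum => x _; apply: ler_norm.
  by rewrite -lerBrDl ler_pdivrMr // lt_neqAle eq_sym M_neq0.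
(* Squaring is monotone on nonnegative numbers; the extent is nonnegative because it dominates the
   left side. *)
split=> //; rewrite ler_sqr ?nnegrE //; last apply: le_trans le1.
all: by rewrite addr_ge0 // divr_ge0 // wdist_ge0.
Qed.
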